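(* Let $\mathbf{A}$ and $M$ be positive definite operators in closed subspaces $\mathcal{H}_{\mathbf{A}}$ and $\mathcal{H}_M$ of a Hilbert space $\mathcal{H}$, respectively, with $M$ bounded, let $F:\mathcal{H}_M\to\mathcal{H}_{\mathbf{A}}$ be a bounded operator, put $D=1/\|\mathbf{A}^{-1}\|$ and assume $\|M\|<D$. Let $|||\cdot|||$ be a symmetric norm, with associated ideal $\mathcal{S}\subset\mathcal{L}(\mathcal{H})$, which has the property $(\mathcal{P})$: if $\sup_n|||A_n|||<\infty$ and $A=\text{w-}\lim_n A_n$, then $A\in\mathcal{S}$ and $|||A|||\le\sup_n|||A_n|||$. If $|||F|||<\infty$, then there exists a unique bounded operator $T:\mathcal{H}_M\to\mathcal{H}_{\mathbf{A}}$ such that $$(\mathbf{A}^{1/2}v,\,TM^{-1/2}u)-(v,\,\mathbf{A}^{-1/2}TM^{1/2}u)=(v,Fu)\qquad\text{for all } v\in\mathcal{D}(\mathbf{A}^{1/2}),\ u\in\mathcal{H}_M,$$ and $$|||T|||\le\frac{\sqrt{D\|M\|}}{D-\|M\|}\,|||F||| .$$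
   Context: A positive definite operator is a (possibly unbounded) selfadjoint operator bounded below by a positive constant; $\mathbf{A}$ may be unbounded. $\mathcal{D}(\cdot)$ denotes the domain, $\mathcal{L}(\mathcal{H})$ the algebra of bounded operators on $\mathcal{H}$, $\|\cdot\|$ the operator norm, and w-lim the limit in the weak operator topology. Bounded operators between subspaces of $\mathcal{H}$ (such as $F$ and $T$) are regarded as elements of $\mathcal{L}(\mathcal{H})$ by extending them by zero on the orthogonal complement. A symmetric norm $|||\cdot|||$ on a subspace $\mathcal{S}\subset\mathcal{L}(\mathcal{H})$ is a norm such that: (i) if $B\in\mathcal{S}$ and $A,C\in\mathcal{L}(\mathcal{H})$ then $ABC\in\mathcal{S}$ and $|||ABC|||\le\|A\|\,|||B|||\,\|C\|$; (ii) if $A$ has rank $1$ then $|||A|||=\|A\|$; (iii) if $A\in\mathcal{S}$ and $U,V$ are unitary on $\mathcal{H}$ then $UAV\in\mathcal{S}$ and $|||UAV|||=|||A|||$; (iv) $\mathcal{S}$ is complete under $|||\cdot|||$. The subspace $\mathcal{S}$ is the $|||\cdot|||$-closure of the set of all finite rank operators. The notation $|||X|||<\infty$ (or a finite bound on $|||X|||$) means $X\in\mathcal{S}$. *)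

(* Defs.v *)
From HB Require Import structures.
From mathcomp Require Import all_boot all_order all_algebra.
From mathcomp Require Import sesquilinear complex.
From mathcomp Require Import boolp classical_sets functions reals.
From mathcomp Require Import topology normedtype sequences.

Set Implicit Arguments.
Unset Strict Implicit.
Unset Printing Implicit Defensive.

Import Order.TTheory GRing.Theory Num.Theory numFieldNormedType.Exports.

Local Open Scope classical_set_scope.
Local Open Scope ring_scope.
Local Open Scope complex_scope.

(* Complex Hilbert spaces. The form is linear in its first argument and
   conjugate-linear in the second one. *)
HB.mixin Record NormedModule_isHilbert (R : realType) H
    of CompleteNormedModule R[i] H := {
  inner : {dot H for Num.conj};
  norm_inner : forall x : H, `|x| ^+ 2 = inner x x
}.

#[short(type="hilbertType")]
HB.structure Definition Hilbert (R : realType) :=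
  {H of NormedModule_isHilbert R H & CompleteNormedModule R[i] H}.

Notation "''[' x , y ]" := (inner x y) : ring_scope.

Section Operators.
Context {R : realType} {H : hilbertType R}.
Implicit Types (K L : set H) (A B : H -> H) (x y u v : H).

(* The norm of a normedModType R[i] takes its values in R[i]; this is the same
   norm as a real number. *)
Definition hnorm x : R := complex.Re `|x|.

Definition closed_subspace K :=
  [/\ K 0, forall (a : R[i]) x y, K x -> K y -> K (a *: x + y) & closed K].

(* Possibly unbounded operators. The values of app outside dom are
   meaningless. *)
Record operator := Operator { dom : set H; app :> H -> H }.

HB.instance Definition _ := gen_eqMixin operator.
HB.instance Definition _ := gen_choiceMixin operator.

Implicit Types S T : operator.

Definition total A := Operator setT A.

Definition graph T : set (H * H) := [set p | dom T p.1 /\ p.2 = T p.1].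

Definition densely_defined_in K T :=
  [/\ dom T `<=` K, K `<=` closure (dom T) & forall x, dom T x -> K (T x)].

Definition linear_on_domain T :=
  dom T 0 /\
  forall (a : R[i]) x y, dom T x -> dom T y ->
    dom T (a *: x + y) /\ T (a *: x + y) = a *: T x + T y.

(* Graph of the adjoint, taken in the Hilbert space K. *)
Definition adjoint_graph K T : set (H * H) :=
  [set p | [/\ K p.1, K p.2 &
              forall x, dom T x -> '[T x, p.1] = '[x, p.2]]].

Definition selfadjoint_in K T :=
  [/\ densely_defined_in K T, linear_on_domain T &
      adjoint_graph K T = graph T].

Definition positive_definite_in K T :=
  selfadjoint_in K T /\
  exists2 c : R, 0 < c & forall x, dom T x -> c%:C * '[x, x] <= '[T x, x].

Definition nonnegative T := forall x, dom T x -> 0 <= '[T x, x].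

Definition op_comp S T :=
  Operator [set x | dom T x /\ dom S (T x)] (fun x => S (T x)).

(* S is a nonnegative selfadjoint operator in K with S ^ 2 = T, an equality of
   operators that includes the equality of their domains. *)
Definition is_sqrt K T S :=
  [/\ selfadjoint_in K S, nonnegative S & graph (op_comp S S) = graph T].

(* T ^ (1/2): the (unique) square root above, with the dummy value T when
   there is none. *)
Definition op_sqrt K T : operator := xget T [set S | is_sqrt K T S].

(* Meant for injective T. *)
Definition op_inv T :=
  Operator (T @` dom T) (fun y => xget 0 [set x | dom T x /\ T x = y]).

Definition op_bounded T :=
  exists c : R, forall x, dom T x -> hnorm (T x) <= c * hnorm x.

Definition opnorm T : R :=
  sup [set hnorm (T x) | x in [set x | dom T x /\ hnorm x <= 1]].

Definition bounded_op A := linear A /\ op_bounded (total A).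

(* Bounded operators K -> L, extended by zero on the orthogonal complement
   of K. *)
Definition bounded_op_between K L A :=
  [/\ bounded_op A, forall x, K x -> L (A x) &
      forall x, (forall y, K y -> '[x, y] = 0) -> A x = 0].

Definition unitary A :=
  [/\ linear A, forall x y, '[A x, A y] = '[x, y] & range A = setT].

Definition finite_rank A :=
  bounded_op A /\
  exists (n : nat) (e : 'I_n -> H), forall x,
    exists c : 'I_n -> R[i], A x = \sum_(i < n) c i *: e i.

Definition rank_one A :=
  bounded_op A /\
  exists2 e : H, e != 0 & range A = [set a *: e | a in [set: R[i]]].

Definition weak_limit (A_ : nat -> H -> H) A :=
  bounded_op A /\
  forall x y, (fun n => '[A_ n x, y] : R[i]^o) @ \oo --> ('[A x, y] : R[i]^o).

(* nrm is a symmetric norm on the ideal I; nrm is only meaningful on I. *)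
Record symmetric_norm (I : set (H -> H)) (nrm : (H -> H) -> R) : Prop := {
  symn_bounded : I `<=` bounded_op;
  symn_subspace : I 0 /\ forall (a : R[i]) A B, I A -> I B -> I (a *: A + B);
  symn_ge0 : forall A, I A -> 0 <= nrm A;
  symn_eq0 : forall A, I A -> nrm A = 0 -> A = 0;
  symn_scale : forall (a : R[i]) A, I A ->
    nrm (a *: A) = complex.Re `|a| * nrm A;
  symn_triangle : forall A B, I A -> I B -> nrm (A + B) <= nrm A + nrm B;
  symn_ideal : forall A B C, I B -> bounded_op A -> bounded_op C ->
    I (A \o B \o C) /\
    nrm (A \o B \o C) <= opnorm (total A) * nrm B * opnorm (total C);
  symn_rank1 : forall A, rank_one A -> nrm A = opnorm (total A);
  symn_unitary : forall A U V, I A -> unitary U -> unitary V ->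
    I (U \o A \o V) /\ nrm (U \o A \o V) = nrm A;
  symn_complete : forall A_ : nat -> H -> H, (forall n, I (A_ n)) ->
    (forall e : R, 0 < e -> exists N, forall m n, (N <= m)%N -> (N <= n)%N ->
       nrm (A_ m - A_ n) < e) ->
    exists2 A, I A & (fun n => nrm (A_ n - A)) @ \oo --> (0 : R);
  (* I is the nrm-closure of the set of finite rank operators. *)
  symn_finite_rank : finite_rank `<=` I;
  symn_dense : forall A, I A -> forall e : R, 0 < e ->
    exists2 B, finite_rank B & nrm (A - B) < e
}.

Definition property_P (I : set (H -> H)) (nrm : (H -> H) -> R) :=
  forall (A_ : nat -> H -> H) A,
    (forall n, I (A_ n)) -> has_ubound (range (fun n => nrm (A_ n))) ->
    weak_limit A_ A ->
    I A /\ nrm A <= sup (range (fun n => nrm (A_ n))).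

End Operators.

Arguments operator {R} H.

(* Main.v *)
Require Import Defs.
From mathcomp Require Import all_boot all_order all_algebra.
From mathcomp Require Import complex boolp classical_sets functions reals topology.
From mathcomp Require Import normedtype sequences.
From mathcomp Require Import sesquilinear ring lra.

Set Implicit Arguments.
Unset Strict Implicit.
Unset Printing Implicit Defensive.

Import Order.TTheory GRing.Theory Num.Theory numFieldNormedType.Exports.

Local Open Scope classical_set_scope.
Local Open Scope ring_scope.

(** The equation is a Sylvester equation in disguise. Let [P_A], [P_M] be the
orthogonal projections onto [HA], [HM] and put [B = A^-1 P_A], [N = M P_M],
[b = A^(-1/2) P_A], [n = M^(1/2) P_M], all bounded operators on [H].
Testing the weak equation with [v = b z] and [u = n w] turns it into
  [T = b F n + B T N],
and this can be undone because [b] maps onto the domain of [A^(1/2)] and [n]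
maps [HM] onto itself ([weak_equationP]).

With [alpha = |A^-1| = 1 / D] and [mu = |M|] the map [X |-> B X N] has norm at
most [q = alpha mu < 1], for the operator norm and, by the ideal property, for
the symmetric norm. The first fact gives uniqueness among all bounded
operators ([sandwich_fixpoint_eq0]). The second one makes
[X |-> b F n + B X N] a contraction of the Banach space [I], whose fixed point
satisfies [nrm T <= nrm (b F n) / (1 - q)] ([sylvester_solution]). Since
[|b x|^2 = <b b x, x> = <B x, x> <= alpha |x|^2], one has
[|b| <= sqrt alpha], and similarly [|n| <= sqrt mu]; so
[nrm T <= sqrt (alpha mu) / (1 - alpha mu) nrm F], which is the stated
constant ([resolvent_constant]).

The rest makes sense of the operators above. A selfadjoint operator bounded
below is a bijection from its domain onto its space, because its range is
closed and has a trivial orthogonal complement ([posdef_bijective], which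
rests on the projection theorem). Its square root exists
([sqrt_exists]): the bounded positive operator [B] has a bounded square root
[b], and [b^-1], with domain the range of [b], is a square root of [A].
The square root of [B] is obtained by rescaling [B] so that
[|B x|^2 <= <B x, x>], which makes [1 - B] a contraction, and solving
[Y = (1 - B + Y^2) / 2] by iteration, so that [(1 - Y)^2 = B]. The
iterates commute and are dominated by those of the scalar equation
[y = (1 + y^2) / 2], hence converge in norm. *)

(** * Inner product, norm and the Cauchy-Schwarz inequality *)

Section Hilbert.
Local Open Scope complex_scope.
Context {R : realType} {H : hilbertType R}.
Implicit Types (x y z : H) (K : set H) (T : operator H).

(** Inequalities are proved for this real inner product, which induces the same
norm; identities of complex inner products are recovered by [inner_Re]. *)
Definition rdot x y : R := complex.Re '[x, y].

Lemma normE x : `|x| = (hnorm x)%:C.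
Proof. by rewrite RRe_real // ger0_real. Qed.

Lemma hnorm_ge0 x : 0 <= hnorm x.
Proof. by rewrite -ler0c -normE. Qed.

Lemma inner_norm x : '[x, x] = (hnorm x ^+ 2)%:C.
Proof. by rewrite -norm_inner normE rmorphXn. Qed.

Lemma rdot_norm x : rdot x x = hnorm x ^+ 2.
Proof. by rewrite /rdot inner_norm. Qed.

Lemma hnorm_eq0 x : hnorm x = 0 -> x = 0.
Proof. by move=> h; apply/normr0_eq0; rewrite normE h. Qed.

Lemma hnorm0 : hnorm (0 : H) = 0.
Proof. by rewrite /hnorm normr0. Qed.

Lemma hnormN x : hnorm (- x) = hnorm x.
Proof. by rewrite /hnorm normrN. Qed.

Lemma hnormBC x y : hnorm (x - y) = hnorm (y - x).
Proof. by rewrite -hnormN opprB. Qed.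

Lemma hnormD x y : hnorm (x + y) <= hnorm x + hnorm y.
Proof. by rewrite -lecR rmorphD /= -!normE ler_normD. Qed.

Lemma hnormB x y z : hnorm (x - z) <= hnorm (x - y) + hnorm (y - z).
Proof. by rewrite (le_trans _ (hnormD _ _)) // addrA subrK. Qed.

Lemma hnormZ (a : R[i]) x : hnorm (a *: x) = complex.Re `|a| * hnorm x.
Proof.
by apply: complexI; rewrite -normE normrZ normE rmorphM; congr (_ * _).
Qed.

Lemma hnormZr (a : R) x : 0 <= a -> hnorm (a%:C *: x) = a * hnorm x.
Proof. by move=> a0; rewrite hnormZ ger0_norm ?ler0c. Qed.

Lemma innerC x y : '[x, y] = '[y, x]^*%C.
Proof. by rewrite [LHS](@hermC _ _ _ _ inner) expr0 mul1r. Qed.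

Lemma innerDl x y z : '[x + y, z] = '[x, z] + '[y, z].
Proof. exact: linearDl. Qed.
Lemma innerDr x y z : '[x, y + z] = '[x, y] + '[x, z].
Proof. exact: linearDr. Qed.
Lemma innerBl x y z : '[x - y, z] = '[x, z] - '[y, z].
Proof. exact: linearBl. Qed.
Lemma innerBr x y z : '[x, y - z] = '[x, y] - '[x, z].
Proof. exact: linearBr. Qed.
Lemma inner0l x : '[0, x] = 0.
Proof. exact: linear0l. Qed.
Lemma inner0r x : '[x, 0] = 0.
Proof. exact: linear0r. Qed.
Lemma innerZl a x y : '[a *: x, y] = a * '[x, y].
Proof. exact: linearZl_LR. Qed.
Lemma innerZr a x y : '[x, a *: y] = a^*%C * '[x, y].
Proof. exact: linearZr_LR. Qed.

Lemma rdotC x y : rdot x y = rdot y x.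
Proof. by rewrite /rdot innerC; case: '[_, _]. Qed.
Lemma rdotDl x y z : rdot (x + y) z = rdot x z + rdot y z.
Proof. by rewrite /rdot innerDl raddfD. Qed.
Lemma rdotBl x y z : rdot (x - y) z = rdot x z - rdot y z.
Proof. by rewrite /rdot innerBl raddfB. Qed.
Lemma rdotZl (a : R) x y : rdot (a%:C *: x) y = a * rdot x y.
Proof. by rewrite /rdot innerZl; case: '[_, _] => u v; simpc. Qed.
Lemma rdotZr (a : R) x y : rdot x (a%:C *: y) = a * rdot x y.
Proof. by rewrite rdotC rdotZl rdotC. Qed.
Lemma rdotDr x y z : rdot x (y + z) = rdot x y + rdot x z.
Proof. by rewrite !(rdotC x) rdotDl. Qed.
Lemma rdotBr x y z : rdot x (y - z) = rdot x y - rdot x z.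
Proof. by rewrite !(rdotC x) rdotBl. Qed.

Lemma normB2 x y :
  hnorm (x - y) ^+ 2 = hnorm x ^+ 2 - 2 * rdot x y + hnorm y ^+ 2.
Proof. by rewrite -!rdot_norm rdotBl !rdotBr (rdotC y x); ring. Qed.

(** The discriminant of a nonnegative quadratic polynomial is nonpositive. *)
Lemma quadratic_ge0 (a b c : R) : 0 <= c ->
  (forall t, 0 <= a - 2 * t * b + t ^+ 2 * c) -> b ^+ 2 <= a * c.
Proof.
move=> c0 h; have [c1|/eqP cn] := eqVneq c 0; last first.
  have cp : 0 < c by rewrite lt0r c0 andbT; apply/eqP.
  have := h (b / c).
  have -> : a - 2 * (b / c) * b + (b / c) ^+ 2 * c = (a * c - b ^+ 2) / c.
    by field; apply/eqP.
  by rewrite pmulr_lge0 ?invr_gt0 // subr_ge0.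
have [->|/eqP bn] := eqVneq b 0; first by rewrite c1 mulr0 expr0n.
have := h ((a + 1) / (2 * b)); rewrite c1 mulr0 addr0.
have -> : a - 2 * ((a + 1) / (2 * b)) * b = -1 by field; apply/eqP.
by rewrite ler0N1.
Qed.

Lemma rdot_le x y : `|rdot x y| <= hnorm x * hnorm y.
Proof.
rewrite -ler_sqr ?nnegrE ?mulr_ge0 ?hnorm_ge0 // real_normK ?num_real // exprMn.
apply: quadratic_ge0 => [|t]; first exact: sqr_ge0.
have := sqr_ge0 (hnorm (x - t%:C *: y)).
by rewrite normB2 -(rdot_norm (_ *: _)) rdotZl !rdotZr rdot_norm; lra.
Qed.

(** The imaginary part of an inner product is the real part of the inner product
with ['i *: x]. *)
Lemma inner_Re z1 z2 x y : rdot z1 x = rdot z2 y ->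
  rdot z1 ('i *: x) = rdot z2 ('i *: y) -> '[z1, x] = '[z2, y].
Proof.
rewrite /rdot !innerZr; case: '[_, _] => a b; case: '[_, _] => c d /= ->.
by simpc => ->.
Qed.

Lemma inner_ext x y : (forall z, '[z, x] = '[z, y]) -> x = y.
Proof.
move=> h; apply/eqP; rewrite -subr_eq0; apply/eqP/hnorm_eq0/eqP.
by rewrite -sqrf_eq0 -rdot_norm /rdot innerBr h subrr.
Qed.

(** * Convergence of sequences *)

(** Convergence is phrased with real tolerances because the norm of [H] is
[R[i]]-valued; [hcauchy_cvg] and [closureP] link it to the topology. *)
Definition hcvg (u : nat -> H) l :=
  forall e : R, 0 < e -> exists N, forall n, (N <= n)%N -> hnorm (u n - l) < e.

Definition hcauchy (u : nat -> H) :=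
  forall e : R, 0 < e -> exists N, forall m n, (N <= m)%N -> (N <= n)%N ->
    hnorm (u m - u n) < e.

Lemma hcauchy_cvg u : hcauchy u -> exists l, hcvg u l.
Proof.
move=> hu.
have : cvg (u @ \oo).
  apply/cauchy_cvgP/cauchy_ballP => e; rewrite ltcE /= => /andP[/eqP im re].
  have [N hN] := hu _ re.
  exists (u @` [set n | (N <= n)%N], u @` [set n | (N <= n)%N]).
    by split; exists N => // n /= Nn; exists n.
  move=> [_ _] [[m Nm <-] [n Nn <-]] /=; rewrite -ball_normE /= normE.
  by rewrite ltcE /= im eqxx hN.
move=> /cvg_ex[l /cvgrPdist_lt hl]; exists l => e e0.
have [|N _ hN] := hl e%:C; first by rewrite ltcR.
exists N => n Nn; have := hN n Nn.
by rewrite /= normE ltcR hnormBC.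
Qed.

Lemma closureP K x : closure K x <->
  forall e : R, 0 < e -> exists2 y, K y & hnorm (x - y) < e.
Proof.
split=> [cx e e0|h B /nbhs_ballP[e]].
  have [|y [Ky]] := cx (ball x e%:C).
    by apply: nbhsx_ballx; rewrite ltcR.
  by rewrite -ball_normE /= normE ltcR => ?; exists y.
rewrite /= ltcE /= => /andP[/eqP im re] sB.
have [y Ky xy] := h _ re; exists y; split=> //; apply: sB.
by rewrite -ball_normE /= normE ltcE /= im eqxx.
Qed.

Lemma hcvg_closure K u l : (forall n, K (u n)) -> hcvg u l -> closure K l.
Proof.
move=> Ku ul; apply/closureP => e /ul[N hN]; exists (u N) => //.
by rewrite hnormBC hN.
Qed.

Lemma inv_succ_lt (e : R) : 0 < e ->
  exists N, forall n, (N <= n)%N -> n.+1%:R^-1 < e.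
Proof.
move=> /ltr_add_invr[N]; rewrite add0r => hN; exists N => n Nn.
by apply: le_lt_trans hN; rewrite lef_pV2 ?posrE ?ltr0n // ler_nat.
Qed.

Lemma closure_seq K x : closure K x -> exists2 u, forall n, K (u n) & hcvg u x.
Proof.
move=> /closureP h.
have /choice[u hu] : forall n : nat, exists y, K y /\ hnorm (x - y) < n.+1%:R^-1.
  by move=> n; have [|y Ky ?] := h n.+1%:R^-1; [rewrite invr_gt0|exists y].
exists u => [n|e /inv_succ_lt[N hN]]; first by have [] := hu n.
exists N => n /hN; apply: lt_trans; rewrite hnormBC.
by have [] := hu n.
Qed.

Lemma hcvg_cauchy u l : hcvg u l -> hcauchy u.
Proof.
move=> ul e e0; have [|N hN] := ul (e / 2); first by rewrite divr_gt0.
exists N => m n /hN + /hN; rewrite (hnormBC (u n)) => h1 h2.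
by rewrite (le_lt_trans (hnormB _ l _)) // [e]splitr ltrD.
Qed.

Lemma hcvg_cst l : hcvg (fun=> l) l.
Proof. by move=> e e0; exists 0%N => n _; rewrite subrr hnorm0. Qed.

Lemma hcvg_dominated (C : R) u l v k : 0 <= C ->
  (forall n, hnorm (v n - k) <= C * hnorm (u n - l)) -> hcvg u l -> hcvg v k.
Proof.
move=> C0 h ul e e0; have C1 : 0 < C + 1 by rewrite ltr_wpDl.
have [|N hN] := ul (e / (C + 1)); first exact: divr_gt0.
exists N => n /hN hn; apply: le_lt_trans (h n) _.
apply: le_lt_trans (_ : (C + 1) * hnorm (u n - l) < e).
  by rewrite ler_wpM2r ?hnorm_ge0 // lerDl.
by rewrite mulrC -ltr_pdivlMr.
Qed.

Lemma hcvgZ (a : R[i]) u l : hcvg u l -> hcvg (fun n => a *: u n) (a *: l).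
Proof.
apply: (@hcvg_dominated (complex.Re `|a|)).
  by rewrite -ler0c RRe_real ?ger0_real.
by move=> n; rewrite -scalerBr hnormZ.
Qed.

Lemma hcvgD u l v k : hcvg u l -> hcvg v k -> hcvg (fun n => u n + v n) (l + k).
Proof.
move=> ul vk e e0.
have e2 : 0 < e / 2 by rewrite divr_gt0.
have [N hN] := ul _ e2; have [P hP] := vk _ e2.
exists (maxn N P) => n; rewrite geq_max => /andP[/hN h1 /hP h2].
rewrite opprD addrACA (le_lt_trans (hnormD _ _)) // [e]splitr.
by rewrite ltrD.
Qed.

Lemma le_eps (C a : R) : 0 <= C -> (forall e, 0 < e -> a <= C * e) -> a <= 0.
Proof.
move=> C0 h; rewrite leNgt; apply/negP => a0.
have C1 : 0 < C + 1 by rewrite ltr_wpDl.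
have := h (a / (C + 1)) (divr_gt0 a0 C1).
by rewrite mulrA ler_pdivlMr //; lra.
Qed.

Lemma rdot_lim (w z : H) u l v k : hcvg u l -> hcvg v k ->
  (forall n, rdot w (u n) = rdot z (v n)) -> rdot w l = rdot z k.
Proof.
move=> ul vk h; apply/eqP; rewrite -subr_eq0 -normr_le0; apply/eqP.
apply/eqP; apply: (@le_eps (hnorm w + hnorm z)) => [|e e0].
  by rewrite addr_ge0 ?hnorm_ge0.
have [N hN] := ul _ e0; have [P hP] := vk _ e0.
have := hN _ (leq_maxl N P); have := hP _ (leq_maxr N P).
set n := maxn N P => h2 h1.
have -> : rdot w l - rdot z k = rdot z (v n - k) - rdot w (u n - l).
  by rewrite !rdotBr h; ring.
apply: le_trans (ler_normB _ _) _; rewrite addrC mulrDl.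
apply: lerD; rewrite (le_trans (rdot_le _ _)) //.
  by rewrite ler_wpM2l ?hnorm_ge0 // ltW.
by rewrite ler_wpM2l ?hnorm_ge0 // ltW.
Qed.

Lemma inner_lim (w z : H) u l v k : hcvg u l -> hcvg v k ->
  (forall n, '[w, u n] = '[z, v n]) -> '[w, l] = '[z, k].
Proof.
move=> ul vk h; apply: inner_Re.
  by apply: (rdot_lim ul vk) => n; rewrite /rdot h.
by apply: (rdot_lim (hcvgZ 'i ul) (hcvgZ 'i vk)) => n; rewrite /rdot !innerZr h.
Qed.

Lemma hcvg_unique u l k : hcvg u l -> hcvg u k -> l = k.
Proof. by move=> ul uk; apply: inner_ext => z; apply: (inner_lim ul uk). Qed.

(** * The projection theorem *)

Lemma closed_subspaceD K x y : closed_subspace K -> K x -> K y -> K (x + y).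
Proof. by case=> _ h _ Kx Ky; rewrite -[x]scale1r; apply: h. Qed.

Lemma closed_subspaceZ K (a : R[i]) x : closed_subspace K -> K x -> K (a *: x).
Proof. by case=> K0 h _ Kx; rewrite -[_ *: _]addr0; apply: h. Qed.

Lemma closed_subspaceB K x y : closed_subspace K -> K x -> K y -> K (x - y).
Proof.
by move=> hK Kx Ky; rewrite -scaleN1r addrC; case: hK => _ h _; apply: h.
Qed.

Lemma closed_subspace_lim K u l :
  closed_subspace K -> (forall n, K (u n)) -> hcvg u l -> K l.
Proof. by case=> _ _ cK Ku ul; apply: cK; apply: (hcvg_closure Ku ul). Qed.

(** If [y] almost minimizes the distance to [x], then [x - y] is almost orthogonal
to [K]: moving from [y] along [t z] cannot decrease the squared distance below
[d], which is a quadratic inequality in [t]. *)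
Lemma near_minimizer_rdot K x y (d e : R) : closed_subspace K ->
  (forall z, K z -> d <= hnorm (x - z) ^+ 2) -> 0 <= e ->
  K y -> hnorm (x - y) ^+ 2 <= d + e ^+ 2 ->
  forall z, K z -> `|rdot (x - y) z| <= e * hnorm z.
Proof.
move=> hK hd e0 Ky hy z Kz.
rewrite -ler_sqr ?nnegrE ?mulr_ge0 ?hnorm_ge0 // real_normK ?num_real //.
rewrite exprMn; apply: quadratic_ge0 => [|t]; first exact: sqr_ge0.
have := hd (y + t%:C *: z) (closed_subspaceD hK Ky (closed_subspaceZ t%:C hK Kz)).
rewrite opprD addrA normB2 -(rdot_norm (_ *: _)) rdotZl !rdotZr rdot_norm.
by move: hy; lra.
Qed.

(** Near orthogonality also shows that a minimizing sequence [u] is Cauchy: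
[|u m - u n|^2 = <x - u n, u m - u n> - <x - u m, u m - u n>] is at most
[(r n + r m) |u m - u n|]. Its limit is the projection. *)
Lemma projection_exists K x : closed_subspace K ->
  exists p, K p /\ forall y, K y -> '[x - p, y] = 0.
Proof.
move=> hK; have K0 : K 0 by case: hK.
pose E := [set hnorm (x - y) ^+ 2 | y in K].
have Elb : lbound E 0 by move=> _ [y _ <-]; apply: sqr_ge0.
have Einf : has_inf E by split; [exists (hnorm (x - 0) ^+ 2), 0|exists 0].
have hd z : K z -> inf E <= hnorm (x - z) ^+ 2.
  by move=> Kz; apply: ge_inf; [exists 0|exists z].
pose r (n : nat) : R := n.+1%:R^-1.
have r0 n : 0 < r n by rewrite invr_gt0.
have /choice[u hu] : forall n, exists y,
    K y /\ hnorm (x - y) ^+ 2 <= inf E + r n ^+ 2.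
  move=> n; have [_ [y Ky <-] /ltW hy] := inf_adherent (exprn_gt0 2 (r0 n)) Einf.
  by exists y.
have Ku n : K (u n) by have [] := hu n.
have hr n z : K z -> `|rdot (x - u n) z| <= r n * hnorm z.
  by have [_ hn] := hu n; apply: (near_minimizer_rdot hK hd) => //; apply: ltW.
have hmn m n : hnorm (u m - u n) <= r m + r n.
  have [->|/eqP mn] := eqVneq (hnorm (u m - u n)) 0.
    by rewrite addr_ge0 // ltW.
  have p0 : 0 < hnorm (u m - u n) by rewrite lt0r hnorm_ge0 andbT; apply/eqP.
  have Kz := closed_subspaceB hK (Ku m) (Ku n).
  rewrite -(ler_pM2r p0) -expr2 -rdot_norm mulrDl.
  have -> : rdot (u m - u n) (u m - u n) =
      rdot (x - u n) (u m - u n) - rdot (x - u m) (u m - u n).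
    by rewrite -rdotBl; congr rdot; rewrite opprB [RHS]addrC addrA subrK.
  rewrite [leRHS]addrC (le_trans (ler_norm _)) // (le_trans (ler_normB _ _)) //.
  by rewrite lerD ?hr.
have /hcauchy_cvg[p up] : hcauchy u.
  move=> e e0; have [|N hN] := @inv_succ_lt (e / 2); first by rewrite divr_gt0.
  exists N => m n /hN h1 /hN h2.
  by rewrite (le_lt_trans (hmn m n)) // [e]splitr ltrD.
have Kp : K p := closed_subspace_lim hK Ku up.
have orth z : K z -> rdot (x - p) z = 0.
  move=> Kz; apply/eqP; rewrite -normr_le0.
  apply: (@le_eps (hnorm z + hnorm z)) => [|e e0].
    by rewrite addr_ge0 ?hnorm_ge0.
  have [N hN] := up _ e0; have [P hP] := inv_succ_lt e0.
  have := hN _ (leq_maxl N P); have := hP _ (leq_maxr N P).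
  set n := maxn N P => h2 h1.
  have -> : rdot (x - p) z = rdot (x - u n) z + rdot (u n - p) z.
    by rewrite -rdotDl addrA subrK.
  rewrite (le_trans (ler_normD _ _)) // mulrDl lerD //.
    by rewrite (le_trans (hr n z Kz)) // mulrC ler_wpM2l ?hnorm_ge0 // ltW.
  by rewrite (le_trans (rdot_le _ _)) // mulrC ler_wpM2l ?hnorm_ge0 // ltW.
exists p; split=> // y Ky; rewrite -(inner0l y); apply: inner_Re.
  by rewrite orth // /rdot inner0l.
by rewrite orth ?/rdot ?inner0l //; apply: closed_subspaceZ.
Qed.

Definition proj K x := xget 0 [set p | K p /\ forall y, K y -> '[x - p, y] = 0].

Section Projection.
Variable K : set H.
Hypothesis hK : closed_subspace K.

Lemma proj_in x : K (proj K x).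
Proof.
rewrite /proj; case: xgetP => [p _ []//|h].
by have [p hp] := projection_exists x hK; case: (h p).
Qed.

Lemma proj_orth x y : K y -> '[x - proj K x, y] = 0.
Proof.
rewrite /proj; case: xgetP => [p _ [_]|h]; first exact.
by have [p hp] := projection_exists x hK; case: (h p).
Qed.

Lemma projEl x y : K y -> '[proj K x, y] = '[x, y].
Proof. by move/(proj_orth x)/eqP; rewrite innerBl subr_eq0 eq_sym => /eqP. Qed.

Lemma projEr x y : K y -> '[y, proj K x] = '[y, x].
Proof. by move=> Ky; rewrite innerC projEl // -innerC. Qed.

Lemma proj_unique x p : K p -> (forall y, K y -> '[x - p, y] = 0) -> proj K x = p.
Proof.
move=> Kp hp; apply/eqP; rewrite -subr_eq0; apply/eqP/hnorm_eq0/eqP.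
have Kz := closed_subspaceB hK (proj_in x) Kp.
rewrite -sqrf_eq0 -rdot_norm /rdot {1}[_ - p](_ : _ = x - p - (x - proj K x)).
  by rewrite innerBl hp // proj_orth // subrr.
by rewrite opprB [RHS]addrC addrA subrK.
Qed.

Lemma proj_id x : K x -> proj K x = x.
Proof. by move=> Kx; apply: proj_unique => // y _; rewrite subrr inner0l. Qed.

Lemma proj_eq0 x : (forall y, K y -> '[x, y] = 0) -> proj K x = 0.
Proof.
by move=> h; apply: proj_unique => [|y Ky]; [case: hK|rewrite subr0 h].
Qed.

Lemma proj_linear : linear (proj K).
Proof.
move=> a x y; apply: proj_unique => [|z Kz].
  by case: (hK) => _ h _; apply: h; apply: proj_in.
by rewrite innerBl !innerDl !innerZl !projEl // subrr.
Qed.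

Lemma proj_norm x : hnorm (proj K x) <= hnorm x.
Proof.
have [->|/eqP n0] := eqVneq (hnorm (proj K x)) 0; first exact: hnorm_ge0.
have p0 : 0 < hnorm (proj K x) by rewrite lt0r hnorm_ge0 andbT; apply/eqP.
rewrite -(ler_pM2r p0) -expr2 -rdot_norm /rdot projEl; last exact: proj_in.
by rewrite (le_trans (ler_norm _)) // rdot_le.
Qed.

End Projection.

(** * Selfadjoint operators and their inverses *)

Section LinearMap.
Variable A : H -> H.
Hypothesis linA : linear A.

Lemma linmap0 : A 0 = 0.
Proof. by have := linA (-1) 0 0; rewrite scaler0 addr0 scaleN1r addNr. Qed.
Lemma linmapD x y : A (x + y) = A x + A y.
Proof. by have := linA 1 x y; rewrite !scale1r. Qed.
Lemma linmapZ a x : A (a *: x) = a *: A x.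
Proof. by have := linA a x 0; rewrite linmap0 !addr0. Qed.
Lemma linmapB x y : A (x - y) = A x - A y.
Proof. by rewrite linmapD -scaleN1r linmapZ scaleN1r. Qed.

(** Linearity over the complex numbers lets one test with ['i *: y] as well. *)
Lemma linear_rdot_sym : (forall x y, rdot (A x) y = rdot x (A y)) ->
  forall x y, '[A x, y] = '[x, A y].
Proof. by move=> h x y; apply: inner_Re; rewrite -?linmapZ h. Qed.

End LinearMap.

Section Selfadjoint.
Variables (K : set H) (T : operator H).
Hypotheses (hK : closed_subspace K) (hT : selfadjoint_in K T).

Lemma selfadjoint_in_sub x : dom T x -> K x.
Proof. by case: hT => -[h _ _] _ _; apply: h. Qed.

Lemma selfadjoint_in_val x : dom T x -> K (T x).
Proof. by case: hT => -[_ _ h] _ _; apply: h. Qed.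

Lemma selfadjoint_sym x y : dom T x -> dom T y -> '[T x, y] = '[x, T y].
Proof.
case: hT => _ _ e dx dy; have : graph T (y, T y) by [].
by rewrite -e => -[_ _]; apply.
Qed.

Lemma selfadjoint_dom x y : K x -> K y ->
  (forall z, dom T z -> '[T z, x] = '[z, y]) -> dom T x /\ T x = y.
Proof.
case: hT => _ _ e Kx Ky h.
by have : adjoint_graph K T (x, y) by []; rewrite e => -[].
Qed.

(** The graph of a selfadjoint operator is closed, being the graph of an
adjoint. *)
Lemma selfadjoint_closed u x y : (forall n, dom T (u n)) ->
  hcvg u x -> hcvg (fun n => T (u n)) y -> dom T x /\ T x = y.
Proof.
move=> du ux uy; apply: selfadjoint_dom => [||z dz].
- by apply: (closed_subspace_lim hK _ ux) => n; apply: selfadjoint_in_sub.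
- by apply: (closed_subspace_lim hK _ uy) => n; apply: selfadjoint_in_val.
- by apply: (inner_lim ux uy) => n; apply: selfadjoint_sym.
Qed.

Lemma domain0 : dom T 0 /\ T 0 = 0.
Proof.
case: hT => _ [d0 l] _; split=> //; have [_] := l (-1) 0 0 d0 d0.
by rewrite scaler0 addr0 scaleN1r addNr.
Qed.

Lemma domainB x y : dom T x -> dom T y -> dom T (x - y) /\ T (x - y) = T x - T y.
Proof.
case: hT => _ [_ l] _ dx dy; have := l (-1) y x dy dx.
by rewrite !scaleN1r ![- _ + _]addrC.
Qed.

Definition bijective_onto :=
  (forall x, dom T x -> T x = 0 -> x = 0) /\
  (forall y, K y -> exists2 x, dom T x & T x = y).

(** The inverse of [T], extended by zero to the orthogonal complement of [K] so
that it becomes an operator on all of [H]. *)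
Definition einv x := op_inv T (proj K x).

Hypothesis bT : bijective_onto.

Lemma domain_inj x y : dom T x -> dom T y -> T x = T y -> x = y.
Proof.
move=> dx dy e; have [dB TB] := domainB dx dy.
by apply/eqP; rewrite -subr_eq0; apply/eqP/bT.1 => //; rewrite TB e subrr.
Qed.

Lemma op_invP y : K y -> dom T (op_inv T y) /\ T (op_inv T y) = y.
Proof.
move=> Ky; rewrite /op_inv /=; case: xgetP => [x _ //|h].
by have [x dx e] := bT.2 y Ky; case: (h x).
Qed.

Lemma op_inv_dom : dom (op_inv T) = K.
Proof.
apply/seteqP; split=> [_ [x dx <-]|y Ky]; first exact: selfadjoint_in_val.
by have [x dx <-] := bT.2 y Ky; exists x.
Qed.

Lemma op_invK x : dom T x -> op_inv T (T x) = x.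
Proof.
move=> dx; have [di e] := op_invP (selfadjoint_in_val dx).
exact: domain_inj.
Qed.

Lemma einv_dom x : dom T (einv x).
Proof. exact: (op_invP (proj_in hK x)).1. Qed.

Lemma einvK x : T (einv x) = proj K x.
Proof. exact: (op_invP (proj_in hK x)).2. Qed.

Lemma einv_in x : K (einv x).
Proof. exact/selfadjoint_in_sub/einv_dom. Qed.

Lemma einvE y : K y -> op_inv T y = einv y.
Proof. by move=> Ky; rewrite /einv proj_id. Qed.

Lemma einv_op x : dom T x -> einv (T x) = x.
Proof. by move=> dx; rewrite -einvE ?op_invK//; apply: selfadjoint_in_val. Qed.

Lemma einv_linear : linear einv.
Proof.
move=> a x y; case: hT => _ [_ l] _.
have [d e] := l a _ _ (einv_dom x) (einv_dom y).
by apply: domain_inj => //; [apply: einv_dom|rewrite e !einvK proj_linear].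
Qed.

Lemma einv_sym x y : '[einv x, y] = '[x, einv y].
Proof.
rewrite -(projEr hK) -?(projEl hK x) -?einvK; try exact: einv_in.
by rewrite selfadjoint_sym; first [exact: einv_dom|by []].
Qed.

Lemma einv_eq0 x : (forall y, K y -> '[x, y] = 0) -> einv x = 0.
Proof.
move=> h; apply: bT.1; first exact: einv_dom.
by rewrite einvK; apply: proj_eq0.
Qed.

End Selfadjoint.

(** * Positive definite operators are invertible *)

Section PositiveDefinite.
Variables (K : set H) (T : operator H).
Hypotheses (hK : closed_subspace K) (hT : positive_definite_in K T).

Lemma posdef_rdot :
  exists2 c : R, 0 < c & forall x, dom T x -> c * hnorm x ^+ 2 <= rdot (T x) x.
Proof.
case: hT => _ [c c0 h]; exists c => // x /h.
rewrite inner_norm lecE => /andP[_]; rewrite /rdot.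
by case: '[_, _] => u v; simpc.
Qed.

Lemma posdef_bounded_below :
  exists2 c : R, 0 < c & forall x, dom T x -> c * hnorm x <= hnorm (T x).
Proof.
have [c c0 h] := posdef_rdot; exists c => // x dx.
have [->|/eqP n0] := eqVneq (hnorm x) 0; first by rewrite mulr0 hnorm_ge0.
have p0 : 0 < hnorm x by rewrite lt0r hnorm_ge0 andbT; apply/eqP.
rewrite -(ler_pM2r p0) -mulrA -expr2 (le_trans (h _ dx)) //.
by rewrite (le_trans (ler_norm _)) // rdot_le.
Qed.

Lemma posdef_inj x : dom T x -> T x = 0 -> x = 0.
Proof.
have [c c0 h] := posdef_bounded_below => /h + e; rewrite e hnorm0.
rewrite pmulr_rle0 // => n0; apply/hnorm_eq0/eqP.
by rewrite eq_le n0 hnorm_ge0.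
Qed.

(** If [T (u n)] converges then [u] is Cauchy since [T] is bounded below, and
the graph of [T] is closed. *)
Lemma posdef_range_closed : closed_subspace (T @` dom T).
Proof.
have [c c0 hc] := posdef_bounded_below.
have [[_ [_ l] _] _] := hT; have sT := hT.1.
split.
- by have [d0 T0] := domain0 sT; exists 0.
- move=> a _ _ [x dx <-] [y dy <-]; have [d e] := l a x y dx dy.
  by exists (a *: x + y).
move=> y /closure_seq[v hv vy].
have /choice[u hu] : forall n, exists x, dom T x /\ T x = v n.
  by move=> n; have [x] := hv n; exists x.
have vE : v = (fun n => T (u n)) by apply/funext => n; have [] := hu n.
have du n : dom T (u n) by have [] := hu n.
have /hcauchy_cvg[x ux] : hcauchy u.
  move=> e e0; have [|N hN] := hcvg_cauchy vy (e := c * e).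
    by rewrite mulr_gt0.
  exists N => m n hm hn; rewrite -(ltr_pM2l c0).
  apply: le_lt_trans (hN m n hm hn); rewrite vE.
  by have [d <-] := domainB sT (du m) (du n); apply: hc.
rewrite vE in vy; have [dx Tx] := selfadjoint_closed hK sT du ux vy.
by exists x.
Qed.

(** A vector [w] of [K] orthogonal to the range of [T] lies in the domain of the
adjoint, that is of [T], and [T w = 0]; hence [w = 0]. As the range is closed,
it is all of [K]. *)
Lemma posdef_bijective : bijective_onto K T.
Proof.
have sT := hT.1; split=> [|y Ky]; first exact: posdef_inj.
have hL := posdef_range_closed.
have [x dx Tx] := proj_in hL y.
pose w := y - proj (T @` dom T) y.
have [dw Tw] : dom T w /\ T w = 0.
  apply: (selfadjoint_dom sT) => [||z dz].
  - by apply: closed_subspaceB => //; rewrite -Tx; apply: (selfadjoint_in_val sT).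
  - by case: hK.
  - by rewrite inner0r innerC proj_orth ?conjc0 //; exists z.
exists x => //; rewrite Tx; apply/eqP; rewrite eq_sym -subr_eq0.
by apply/eqP/posdef_inj.
Qed.

End PositiveDefinite.

(** * Square roots of bounded positive operators *)

Section ContractionSqrt.
Variable B : H -> H.
Hypotheses (linB : linear B) (symB : forall x y, '[B x, y] = '[x, B y])
  (posB : forall x, hnorm (B x) ^+ 2 <= rdot (B x) x).

(** The limit [Y] of the iteration satisfies [2 Y = 1 - B + Y^2], that is
[(1 - Y)^2 = B]. *)
Fixpoint sqrt_iter n x : H :=
  if n is n'.+1 then 2^-1 *: (x - B x + sqrt_iter n' (sqrt_iter n' x)) else 0.

(** The same iteration with [1 - B] replaced by its norm bound [1]; it dominates
the norms of the iterates and of their increments. *)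
Fixpoint sqrt_bound n : R :=
  if n is n'.+1 then (1 + sqrt_bound n' ^+ 2) / 2 else 0.

Lemma sqrt_bound_itv n : 0 <= sqrt_bound n <= 1.
Proof.
elim: n => [|n /andP[h0 h1]] /=; first by rewrite lexx ler01.
have : sqrt_bound n ^+ 2 <= 1 by rewrite expr_le1.
have := sqr_ge0 (sqrt_bound n); lra.
Qed.

(** The increment is [(1 - y)^2 / 2]. *)
Lemma sqrt_bound_step n : sqrt_bound n <= sqrt_bound n.+1.
Proof. by have := sqr_ge0 (sqrt_bound n - 1) => /=; lra. Qed.

Lemma sqrt_bound_cauchy (e : R) : 0 < e -> exists N, forall m n,
  (N <= n)%N -> (n <= m)%N -> sqrt_bound m - sqrt_bound n < e.
Proof.
move=> e0; pose E := range sqrt_bound.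
have Esup : has_sup E.
  split; first by exists 0, 0%N.
  by exists 1 => _ [n _ <-]; case/andP: (sqrt_bound_itv n).
have [_ [N _ <-] hN] := sup_adherent e0 Esup.
exists N => m n Nn nm; rewrite ltrBlDl.
have mono : {homo sqrt_bound : i j / (i <= j)%N >-> i <= j}.
  by apply: homo_leq => [//|??? ??|]; [apply: le_trans; eassumption|exact: sqrt_bound_step].
have h1 := mono _ _ Nn.
have : sqrt_bound m <= sup E by apply: ub_le_sup; [case: Esup|exists m].
by lra.
Qed.

Lemma sqrt_iter_linear n : linear (sqrt_iter n).
Proof.
elim: n => [|n ih] a x y /=; first by rewrite scaler0 addr0.
rewrite linB !ih scalerA mulrC -scalerA -scalerDr; congr (_ *: _).
by rewrite opprD [X in X + _ = _]addrACA -scalerBr [LHS]addrACA -scalerDr.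
Qed.

Lemma half_double x : 2^-1 *: (x + x) = x.
Proof.
by rewrite -mulr2n -scalerMnr scalerMnl -mulr_natr mulVf ?pnatr_eq0 // scale1r.
Qed.

Lemma hnorm_half x : hnorm (2^-1 *: x) = hnorm x / 2.
Proof.
have -> : 2^-1 = (2^-1 : R)%:C by rewrite fmorphV rmorph_nat.
by rewrite hnormZr ?invr_ge0 // mulrC.
Qed.

(** [|x - B x|^2 = |x|^2 - 2 <B x, x> + |B x|^2]. *)
Lemma hnorm_sub_contraction x : hnorm (x - B x) <= hnorm x.
Proof.
rewrite -ler_sqr ?nnegrE ?hnorm_ge0 // normB2 rdotC.
by have := posB x; have := sqr_ge0 (hnorm (B x)); lra.
Qed.

(** The iterates are polynomials in [B], so they commute with whatever commutes
with [B]. *)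
Lemma sqrt_iter_comm (C : H -> H) : linear C -> (forall x, C (B x) = B (C x)) ->
  forall n x, C (sqrt_iter n x) = sqrt_iter n (C x).
Proof.
move=> linC CB; elim=> [|n ih] x /=; first exact: linmap0.
by rewrite linmapZ // linmapD // linmapB // CB !ih.
Qed.

Lemma sqrt_iter_commB n x : B (sqrt_iter n x) = sqrt_iter n (B x).
Proof. exact: sqrt_iter_comm. Qed.

Lemma sqrt_iterC m n x :
  sqrt_iter m (sqrt_iter n x) = sqrt_iter n (sqrt_iter m x).
Proof.
apply: sqrt_iter_comm => [|y]; first exact: sqrt_iter_linear.
by rewrite sqrt_iter_commB.
Qed.

Lemma sqrt_iter_sym n x y : '[sqrt_iter n x, y] = '[x, sqrt_iter n y].
Proof.
elim: n x y => [|n ih] x y /=; first by rewrite inner0l inner0r.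
rewrite innerZl innerZr innerDl innerBl innerDr innerBr symB !ih.
by congr (_ * _); rewrite conjc_inv conjc_nat.
Qed.

Lemma sqrt_iter_norm n x : hnorm (sqrt_iter n x) <= sqrt_bound n * hnorm x.
Proof.
elim: n x => [|n ih] x /=; first by rewrite hnorm0 mul0r.
have /andP[y0 _] := sqrt_bound_itv n.
rewrite hnorm_half mulrAC ler_pM2r ?invr_gt0 // mulrDl mul1r.
rewrite (le_trans (hnormD _ _)) // lerD ?hnorm_sub_contraction //.
by rewrite (le_trans (ih _)) // expr2 -mulrA ler_wpM2l.
Qed.

Lemma sqrt_iter_norm1 n x : hnorm (sqrt_iter n x) <= hnorm x.
Proof.
rewrite (le_trans (sqrt_iter_norm n x)) // ler_piMl ?hnorm_ge0 //.
by case/andP: (sqrt_bound_itv n).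
Qed.

(** As the iterates commute, the difference of two consecutive squares is
[(Y' - Y) (Y' + Y)]; the scalar sequence obeys the same identity with equality,
which carries the domination through the induction. *)
Lemma sqrt_iter_step n x : hnorm (sqrt_iter n.+1 x - sqrt_iter n x) <=
  (sqrt_bound n.+1 - sqrt_bound n) * hnorm x.
Proof.
elim: n x => [|n ih] x.
  by have := sqrt_iter_norm 1 x; rewrite !subr0.
pose s := sqrt_iter n.+1 x + sqrt_iter n x.
have -> : sqrt_iter n.+2 x - sqrt_iter n.+1 x =
    2^-1 *: (sqrt_iter n.+1 s - sqrt_iter n s).
  rewrite [LHS](_ : _ =
    2^-1 *: (x - B x + sqrt_iter n.+1 (sqrt_iter n.+1 x)) -
    2^-1 *: (x - B x + sqrt_iter n (sqrt_iter n x))) //.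
  rewrite -scalerBr opprD addrACA subrr add0r; congr (_ *: _).
  rewrite /s !(linmapD (sqrt_iter_linear _)) (sqrt_iterC n n.+1 x).
  by rewrite opprD addrACA addrA subrK.
have hs : hnorm s <= (sqrt_bound n.+1 + sqrt_bound n) * hnorm x.
  by rewrite mulrDl (le_trans (hnormD _ _)) // lerD ?sqrt_iter_norm.
have d0 : 0 <= sqrt_bound n.+1 - sqrt_bound n by rewrite subr_ge0 sqrt_bound_step.
rewrite hnorm_half ler_pdivrMr // (le_trans (ih s)) //.
rewrite (le_trans (ler_wpM2l d0 hs)) //=; lra.
Qed.

Lemma sqrt_iter_diff n k x : hnorm (sqrt_iter (k + n) x - sqrt_iter n x) <=
  (sqrt_bound (k + n) - sqrt_bound n) * hnorm x.
Proof.
elim: k => [|k ih]; first by rewrite !subrr hnorm0 mul0r.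
rewrite (le_trans (hnormB _ (sqrt_iter (k + n) x) _)) //.
have := sqrt_iter_step (k + n) x; move: ih; rewrite addSn; lra.
Qed.

Lemma sqrt_iter_cvg x : exists l, hcvg (sqrt_iter^~ x) l.
Proof.
apply: hcauchy_cvg => e e0; have e1 : 0 < e / (hnorm x + 1).
  by rewrite divr_gt0 // ltr_wpDl ?hnorm_ge0.
have [N hN] := sqrt_bound_cauchy e1; exists N.
have key m n : (N <= n)%N -> (n <= m)%N ->
    hnorm (sqrt_iter m x - sqrt_iter n x) < e.
  move=> Nn nm; have := sqrt_iter_diff n (m - n) x; rewrite subnK // => h.
  have := hN m n Nn nm; rewrite ltr_pdivlMr ?ltr_wpDl ?hnorm_ge0 // => h2.
  apply: le_lt_trans h _; apply: le_lt_trans h2.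
  rewrite mulrDr mulr1 lerDl.
  rewrite -(subnK nm) subr_ge0; elim: (m - n)%N => [//|k ih].
  exact: le_trans ih (sqrt_bound_step _).
move=> m n Nm Nn; case: (leqP n m) => [|/ltnW] nm; first exact: key.
by rewrite hnormBC key.
Qed.

(** The square root is [1 - Y]; it is nonnegative because [|Y x| <= |x|]. *)
Lemma contraction_sqrt : exists b : H -> H, [/\ linear b,
  forall x y, '[b x, y] = '[x, b y], forall x, 0 <= rdot (b x) x &
  forall x, b (b x) = B x].
Proof.
have /choice[Y hY] := sqrt_iter_cvg.
have Ylin : linear Y.
  move=> a x y; apply: (hcvg_unique (hY _)).
  have := hcvgD (hcvgZ a (hY x)) (hY y); congr hcvg.
  by apply/funext => n; rewrite sqrt_iter_linear.
have Ysym : forall x y, '[Y x, y] = '[x, Y y].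
  apply: linear_rdot_sym => // x y; rewrite rdotC.
  apply: (rdot_lim (hY x) (hY y)) => n.
  by rewrite rdotC /rdot sqrt_iter_sym.
have Ynorm x : hnorm (Y x) <= hnorm x.
  rewrite -subr_le0; apply: (@le_eps 1) => // e /(hY x)[N /(_ N (leqnn _))].
  have := hnormD (Y x - sqrt_iter N x) (sqrt_iter N x).
  by rewrite subrK hnormBC; have := sqrt_iter_norm1 N x; lra.
(* [Y_n Y_n x = Y_n (Y_n x - Y x) + Y_n (Y x)], where the [Y_n] are
   contractions *)
have YY x : hcvg (fun n => sqrt_iter n (sqrt_iter n x)) (Y (Y x)).
  have h0 : hcvg (fun n => sqrt_iter n (sqrt_iter n x - Y x)) 0.
    apply: (hcvg_dominated ler01) (hY x) => n.
    by rewrite subr0 mul1r sqrt_iter_norm1.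
  have := hcvgD h0 (hY (Y x)); rewrite add0r; congr hcvg; apply/funext => n.
  by rewrite (linmapB (sqrt_iter_linear _)) subrK.
have Yeq x : Y x + Y x = x - B x + Y (Y x).
  have h1 : hcvg (fun n => sqrt_iter n.+1 x) (Y x).
    by move=> e /(hY x)[N hN]; exists N => n Nn; apply: hN; apply: leqW.
  have := hcvgZ 2^-1 (hcvgD (@hcvg_cst (x - B x)) (YY x)).
  move=> /(hcvg_unique h1) e; rewrite {1 2}e -scalerDr.
  exact: half_double.
exists (fun x => x - Y x); split=> [a x y|x y|x|x].
- by rewrite Ylin opprD addrACA scalerBr.
- by rewrite innerBl innerBr Ysym.
- rewrite rdotBl rdot_norm subr_ge0 (le_trans (ler_norm _)) //.
  by rewrite (le_trans (rdot_le _ _)) // expr2 ler_wpM2r ?hnorm_ge0.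
rewrite (linmapB Ylin) opprB addrACA -opprD Yeq opprD addrACA subrr addr0.
by rewrite opprB addrC subrK.
Qed.

End ContractionSqrt.

(** * Square roots of positive definite operators *)

Section SquareRootExistence.
Variables (K : set H) (T : operator H).
Hypotheses (hK : closed_subspace K) (hT : positive_definite_in K T).

Local Notation B := (einv K T).

(** If [T] is bounded below by [c], then [B = T^-1] satisfies
[c |B x|^2 <= <T B x, B x> = <x, B x>], so that [c B] meets the hypothesis of
[contraction_sqrt]. *)
Lemma bounded_sqrt_einv : exists b : H -> H, [/\ linear b,
  forall x y, '[b x, y] = '[x, b y], forall x, 0 <= rdot (b x) x &
  forall x, b (b x) = B x].
Proof.
have sT := hT.1; have bT := posdef_bijective hK hT.
have linB := einv_linear hK sT bT; have symB := einv_sym hK sT bT.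
have [c c0 hc] := posdef_rdot hT.
have posB x : c * hnorm (B x) ^+ 2 <= rdot (B x) x.
  have := hc _ (einv_dom hK bT x); rewrite (einvK hK bT) rdotC.
  by rewrite /rdot projEr //; apply: (einv_in hK sT bT).
pose s : R := Num.sqrt c.
have [|x y|x|b [linb symb posb bb]] := @contraction_sqrt (fun x => c%:C *: B x).
- by move=> a x y; rewrite linB scalerDr !scalerA mulrC.
- by rewrite innerZl innerZr symB conjc_real.
- rewrite (hnormZr _ (ltW c0)) rdotZl exprMn expr2 -mulrA.
  by apply: ler_wpM2l => //; apply: ltW.
have s0 : 0 < s by rewrite sqrtr_gt0.
exists (fun x => s^-1%:C *: b x); split=> [a x y|x y|x|x].
- by rewrite linb scalerDr !scalerA mulrC.
- by rewrite innerZl innerZr symb conjc_real.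
- by rewrite rdotZl mulr_ge0 // invr_ge0 ltW.
rewrite (linmapZ linb) bb !scalerA -!rmorphM -invfM -expr2 (sqr_sqrtr (ltW c0)).
by rewrite mulVf ?scale1r // gt_eqF.
Qed.

(** The root is the inverse of the bounded root [b] of [T^-1]. Its domain [b K] is
dense because it contains [b (b K)], the domain of [T]. It is selfadjoint: if
[<z, x> = <b z, y>] for all [z] in [K], then [x = b y]. *)
Lemma sqrt_exists : exists S, is_sqrt K T S.
Proof.
have sT := hT.1; have bT := posdef_bijective hK hT.
have [b [linb symb posb bb]] := bounded_sqrt_einv.
(* [b] vanishes on the orthogonal complement of [K], since there
   [|b w|^2 = <B w, w> = 0]; being symmetric, it maps into [K] *)
have bK x : K (b x).
  pose w := b x - proj K (b x).
  have wK y : K y -> '[w, y] = 0 by exact: (proj_orth hK).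
  have bw : b w = 0.
    apply/hnorm_eq0/eqP; rewrite -sqrf_eq0 -rdot_norm /rdot symb bb.
    by rewrite (einv_eq0 hK bT) // inner0r.
  have w0 : w = 0.
    apply/hnorm_eq0/eqP; rewrite -sqrf_eq0 -rdot_norm /rdot {2}/w innerBr.
    by rewrite (wK _ (proj_in hK _)) subr0 -symb bw inner0l.
  move/eqP: w0; rewrite subr_eq0 => /eqP ->; exact: (proj_in hK).
have binj z : K z -> b z = 0 -> z = 0.
  move=> Kz bz; have := einvK hK bT z.
  by rewrite -bb bz (linmap0 linb) (domain0 sT).2 proj_id.
have [S dSE Sb] : exists2 S : operator H,
    (forall x, dom S x <-> exists2 z, K z & x = b z) &
    (forall z, K z -> S (b z) = z).
  exists (op_inv (Operator K b)) => [x|z Kz].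
    by split=> [[z Kz <-]|[z Kz ->]]; exists z.
  rewrite /op_inv /=; case: xgetP => [y _ [/= Ky e]|h]; last by case: (h z).
  apply/eqP; rewrite -subr_eq0; apply/eqP/binj; first exact: closed_subspaceB.
  by rewrite (linmapB linb) e subrr.
have dSb z : K z -> dom S (b z) by move=> Kz; apply/dSE; exists z.
have domTE x : dom T x <-> exists2 z, K z & x = b (b z).
  split=> [dx|[z _ ->]]; last by rewrite bb; apply: einv_dom.
  by exists (T x); rewrite ?bb ?einv_op //; apply: (selfadjoint_in_val sT).
exists S; split.
- split.
  + split.
    * by move=> _ /dSE[z _ ->].
    * move=> x Kx; case: sT => -[_ dT _] _ _.
      apply: closureS (dT x Kx) => _ /domTE[z Kz ->].
      exact/dSb/bK.
    * by move=> _ /dSE[z Kz ->]; rewrite Sb.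
  + have K0 : K 0 by case: hK.
    split; first by rewrite -(linmap0 linb); apply: dSb.
    move=> a _ _ /dSE[z Kz ->] /dSE[y Ky ->]; rewrite -linb.
    have Ks : K (a *: z + y) by case: hK => _ h _; apply: h.
    by split; [apply: dSb|rewrite !Sb].
  + apply/seteqP; split=> -[x y].
      move=> [/= Kx Ky h]; have xE : x = b y.
        apply/eqP; rewrite -subr_eq0; apply/eqP/hnorm_eq0/eqP.
        rewrite -sqrf_eq0 -rdot_norm /rdot.
        pose z := x - b y.
        have Kz : K z by apply: closed_subspaceB.
        rewrite -/z {2}/z innerBr -symb -(h (b z)) ?Sb ?subrr //.
        exact: dSb.
      by split; rewrite /= xE ?Sb //; apply: dSb.
    move=> [/= /dSE[z Kz ->] ->]; rewrite Sb //; split=> //= _ /dSE[w Kw ->].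
    by rewrite Sb.
- move=> _ /dSE[z Kz ->]; rewrite Sb // lecE; apply/andP; split.
    have := innerC z (b z); rewrite symb; case: '[_, _] => u v /= [].
    by move=> e; apply/eqP; lra.
  by have := posb z; rewrite rdotC.
- apply/seteqP; split=> -[x y].
    move=> [[/= /dSE[z Kz ->]]]; rewrite Sb // => /dSE[w Kw ->].
    rewrite Sb // => ->; split; first by apply/domTE; exists w.
    by rewrite /= bb einvK // proj_id.
  move=> [/= dx ->]; have /domTE[z Kz xE] := dx.
  rewrite {dx}xE; split; rewrite /= !Sb //; first by split; apply: dSb.
  by rewrite bb einvK // proj_id.
Qed.

Lemma op_sqrtP : is_sqrt K T (op_sqrt K T).
Proof.
rewrite /op_sqrt; case: xgetP => [S _ //|h].
by have [S hS] := sqrt_exists; case: (h S).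
Qed.

End SquareRootExistence.

(** Consequences of [S S = T] for an arbitrary square root [S]. *)
Section SquareRoot.
Variables (K : set H) (T S : operator H).
Hypotheses (hK : closed_subspace K) (sT : selfadjoint_in K T).
Hypotheses (bT : bijective_onto K T) (hS : is_sqrt K T S).

Lemma sqrt_sa : selfadjoint_in K S.
Proof. by case: hS. Qed.

Lemma sqrt_comp x : dom T x -> [/\ dom S x, dom S (S x) & S (S x) = T x].
Proof.
case: hS => _ _ e dx; have : graph T (x, T x) by [].
by rewrite -e => -[/= [? ?] ->].
Qed.

(** [T] is onto and [T = S S], so [S] is onto; and [S x = 0] implies [T x = 0]. *)
Lemma sqrt_bijective : bijective_onto K S.
Proof.
have [d0 S0] := domain0 sqrt_sa.
split=> [x dx Sx|y Ky].
  have : graph (op_comp S S) (x, 0) by split; rewrite /= ?Sx.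
  by case: hS => _ _ -> [/= dTx e]; apply: bT.1.
have [x dx <-] := bT.2 y Ky; have [_ d <-] := sqrt_comp dx.
by exists (S x).
Qed.

Lemma einv_sqrt x : einv K S (einv K S x) = einv K T x.
Proof.
have [d1 d2 e] := sqrt_comp (einv_dom hK bT x).
rewrite -[RHS](einv_op hK sqrt_sa sqrt_bijective) //.
rewrite -[S (einv K T x)](einv_op hK sqrt_sa sqrt_bijective) // e einvK //.
by congr einv; rewrite /einv (proj_id hK (proj_in hK x)).
Qed.

End SquareRoot.

(** * Operator norms *)

Lemma opnorm_le T (C : R) : dom T 0 -> 0 <= C ->
  (forall x, dom T x -> hnorm (T x) <= C * hnorm x) -> opnorm T <= C.
Proof.
move=> d0 C0 h; apply: ge_sup.
  by exists (hnorm (T 0)), 0 => //; split; rewrite // hnorm0.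
move=> _ [x [dx x1] <-]; rewrite (le_trans (h _ dx)) //.
by rewrite ler_piMr.
Qed.

Lemma opnorm_has_ubound T : op_bounded T ->
  has_ubound [set hnorm (T x) | x in [set x | dom T x /\ hnorm x <= 1]].
Proof.
move=> [c hc]; exists `|c| => _ [x [dx x1] <-].
rewrite (le_trans (hc _ dx)) // (le_trans (ler_norm _)) // normrM.
by rewrite ler_piMr // ger0_norm ?hnorm_ge0.
Qed.

Lemma opnorm_ge0 T : dom T 0 -> op_bounded T -> 0 <= opnorm T.
Proof.
move=> d0 bT; apply: le_trans (hnorm_ge0 (T 0)) _.
apply: ub_le_sup; first exact: opnorm_has_ubound.
by exists 0 => //; split; rewrite // hnorm0.
Qed.

Lemma le_opnorm T x : linear_on_domain T -> op_bounded T -> dom T x ->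
  hnorm (T x) <= opnorm T * hnorm x.
Proof.
move=> [d0 l] bT dx; have T0 : T 0 = 0.
  by have [_] := l (-1) 0 0 d0 d0; rewrite scaler0 addr0 scaleN1r addNr.
have [/hnorm_eq0 ->|/eqP n0] := eqVneq (hnorm x) 0.
  by rewrite T0 hnorm0 mulr0.
have p0 : 0 < hnorm x by rewrite lt0r hnorm_ge0 andbT; apply/eqP.
have i0 : 0 <= (hnorm x)^-1 by rewrite invr_ge0 ltW.
have [d e] := l (hnorm x)^-1%:C x 0 dx d0.
rewrite -ler_pdivrMr // mulrC -hnormZr //.
rewrite addr0 T0 addr0 in d e; rewrite -e.
apply: ub_le_sup; first exact: opnorm_has_ubound.
exists ((hnorm x)^-1%:C *: x) => //; split=> //.
by rewrite hnormZr // mulVf //; apply/eqP.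
Qed.

(** The domain is dense, [T] maps Cauchy sequences to Cauchy sequences, and its
graph is closed. *)
Lemma bounded_selfadjoint_total K T x : closed_subspace K ->
  selfadjoint_in K T -> op_bounded T -> K x -> dom T x.
Proof.
move=> hK sT [c hc] Kx; case: (sT) => -[_ dT _] _ _.
have [u du ux] := closure_seq (dT x Kx).
have /hcauchy_cvg[y uy] : hcauchy (fun n => T (u n)).
  move=> e e0; have c1 : 0 < `|c| + 1 by rewrite ltr_wpDl.
  have [|N hN] := hcvg_cauchy ux (e := e / (`|c| + 1)).
    by rewrite divr_gt0.
  exists N => m n hm hn; have := hN m n hm hn; rewrite ltr_pdivlMr // mulrC.
  apply: le_lt_trans; have [d <-] := domainB sT (du m) (du n).
  rewrite (le_trans (hc _ d)) // ler_wpM2r ?hnorm_ge0 //.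
  by rewrite (le_trans (ler_norm _)) // lerDl.
by have [] := selfadjoint_closed hK sT du ux uy.
Qed.

Lemma le_sqrt_of_sq (a y z : R) :
  0 <= a -> 0 <= z -> y ^+ 2 <= a * z ^+ 2 -> y <= Num.sqrt a * z.
Proof.
move=> a0 z0 h; have s0 := mulr_ge0 (sqrtr_ge0 a) z0.
have [y0|y0] := leP 0 y; last by rewrite (le_trans (ltW y0)).
by rewrite -ler_sqr ?nnegrE // exprMn sqr_sqrtr.
Qed.

Section InverseNorm.
Variables (K : set H) (T : operator H).
Hypotheses (hK : closed_subspace K) (hT : positive_definite_in K T).

Let sT := hT.1.
Let bT := posdef_bijective hK hT.
Let S := op_sqrt K T.
Let hS := op_sqrtP hK hT.
Let sS := sqrt_sa hS.
Let bS := sqrt_bijective bT hS.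

Lemma op_inv_bounded : op_bounded (op_inv T).
Proof.
have [c c0 hc] := posdef_bounded_below hT.
exists c^-1; rewrite (op_inv_dom sT bT) => y Ky.
have [d e] := op_invP bT Ky.
by rewrite mulrC ler_pdivlMr // mulrC -{2}e hc.
Qed.

Lemma op_inv_linear : linear_on_domain (op_inv T).
Proof.
split; first by rewrite (op_inv_dom sT bT); case: hK.
move=> a x y; rewrite (op_inv_dom sT bT) => Kx Ky.
have Ks : K (a *: x + y) by case: hK => _ h _; apply: h.
by split=> //; rewrite !(einvE T hK) // einv_linear.
Qed.

Lemma einv_norm x : hnorm (einv K T x) <= opnorm (op_inv T) * hnorm x.
Proof.
have a0 : 0 <= opnorm (op_inv T).
  by apply: opnorm_ge0; [case: op_inv_linear|exact: op_inv_bounded].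
apply: le_trans (_ : opnorm (op_inv T) * hnorm (proj K x) <= _).
  apply: le_opnorm; [exact: op_inv_linear|exact: op_inv_bounded|].
  by rewrite (op_inv_dom sT bT); apply: (proj_in hK).
by rewrite ler_wpM2l // proj_norm.
Qed.

(** [|S^-1 x|^2 = <S^-1 S^-1 x, x> = <T^-1 x, x>]. *)
Lemma einv_sqrt_norm x :
  hnorm (einv K S x) <= Num.sqrt (opnorm (op_inv T)) * hnorm x.
Proof.
apply: le_sqrt_of_sq; rewrite ?hnorm_ge0 //.
  by apply: opnorm_ge0; [case: op_inv_linear|exact: op_inv_bounded].
rewrite -rdot_norm /rdot (einv_sym hK sS bS) (einv_sqrt hK bT hS) -/(rdot _ _).
rewrite (le_trans (ler_norm _)) // (le_trans (rdot_le _ _)) //.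
by rewrite mulrC expr2 mulrA ler_wpM2r ?hnorm_ge0 // einv_norm.
Qed.

End InverseNorm.

(** [T] extended by zero to the orthogonal complement of [K]. *)
Definition ext K T x := (T : operator H) (proj K x).

Section BoundedExtension.
Variables (K : set H) (T : operator H).
Hypotheses (hK : closed_subspace K) (hT : positive_definite_in K T).
Hypothesis bndT : op_bounded T.

Let sT := hT.1.
Let S := op_sqrt K T.
Let hS := op_sqrtP hK hT.

Lemma dom_bounded_sqrt x : K x -> dom S x.
Proof.
move=> Kx; have dx := bounded_selfadjoint_total hK sT bndT Kx.
by have [] := sqrt_comp hS dx.
Qed.

Lemma ext_linear U : selfadjoint_in K U -> (forall x, K x -> dom U x) ->
  linear (ext K U).
Proof.
move=> [_ [_ l] _] d a x y; rewrite /ext proj_linear //.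
by apply: (l _ _ _ _ _).2; apply/d/(proj_in hK).
Qed.

Lemma ext_norm x : hnorm (ext K T x) <= opnorm T * hnorm x.
Proof.
have [_ lT _] := sT.
apply: le_trans (_ : opnorm T * hnorm (proj K x) <= _).
  apply: le_opnorm => //.
  exact/(bounded_selfadjoint_total hK sT bndT)/(proj_in hK).
rewrite ler_wpM2l ?proj_norm //; apply: opnorm_ge0 => //.
by case: lT.
Qed.

(** For [x] in [K], [|S x|^2 = <S S x, x> = <T x, x>]. *)
Lemma ext_sqrt_norm x : hnorm (ext K S x) <= Num.sqrt (opnorm T) * hnorm x.
Proof.
have [_ [d0 _] _] := sT; have sS := sqrt_sa hS.
have Kp := proj_in hK x; have dp := bounded_selfadjoint_total hK sT bndT Kp.
have [d1 d2 e] := sqrt_comp hS dp.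
apply: le_sqrt_of_sq; rewrite ?hnorm_ge0 ?opnorm_ge0 //.
rewrite -rdot_norm /rdot /ext -(selfadjoint_sym sS d2 d1) e -/(rdot _ _).
rewrite (le_trans (ler_norm _)) // (le_trans (rdot_le _ _)) //.
by rewrite expr2 mulrA ler_pM ?hnorm_ge0 ?ext_norm ?proj_norm.
Qed.

End BoundedExtension.

(** * The equation [T = G + B T N] in a symmetrically normed ideal *)

Lemma le_opnorm_total (A : H -> H) x :
  bounded_op A -> hnorm (A x) <= opnorm (Defs.total A) * hnorm x.
Proof.
move=> [linA bA]; apply: (@le_opnorm (Defs.total A)) => //.
by split=> // a y z _ _; split=> //=; apply: linA.
Qed.

Lemma bounded_op_norm (A : H -> H) (C : R) : linear A ->
  (forall x, hnorm (A x) <= C * hnorm x) -> bounded_op A.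
Proof. by move=> linA h; split=> //; exists C. Qed.

Lemma bounded_op_sub (A B : H -> H) :
  bounded_op A -> bounded_op B -> bounded_op (A - B).
Proof.
move=> bA bB; apply: (@bounded_op_norm _ (opnorm (Defs.total A) + opnorm (Defs.total B))).
  have AB z : (A - B) z = A z - B z by [].
  by move=> a x y; rewrite !AB bB.1 bA.1 opprD addrACA scalerBr.
move=> x; rewrite (le_trans (hnormD _ _)) // hnormN mulrDl.
by rewrite lerD // le_opnorm_total.
Qed.

Section Sylvester.
Variables (B N : H -> H) (alpha mu : R).
Hypotheses (bB : bounded_op B) (bN : bounded_op N).
Hypotheses (alpha0 : 0 <= alpha) (mu0 : 0 <= mu) (q1 : alpha * mu < 1).
Hypotheses (normB : forall x, hnorm (B x) <= alpha * hnorm x)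
  (normN : forall x, hnorm (N x) <= mu * hnorm x).

Let q := alpha * mu.
Let q0 : 0 <= q := mulr_ge0 alpha0 mu0.

(** [|Z| <= q |Z|] in operator norm. Together with linearity this gives the
uniqueness of bounded solutions, whether or not they lie in the ideal. *)
Lemma sandwich_fixpoint_eq0 (Z : H -> H) :
  bounded_op Z -> (forall x, Z x = B (Z (N x))) -> forall x, Z x = 0.
Proof.
move=> bZ hZ x; have z0 : 0 <= opnorm (Defs.total Z) by apply: opnorm_ge0; case: bZ.
have : opnorm (Defs.total Z) <= q * opnorm (Defs.total Z).
  apply: opnorm_le => //= [|y _]; first exact: mulr_ge0.
  rewrite hZ (le_trans (normB _)) // /q -!mulrA ler_wpM2l //.
  rewrite (le_trans (le_opnorm_total _ bZ)) // mulrCA ler_wpM2l //.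
have q1' : 0 < 1 - q by rewrite subr_gt0.
rewrite -subr_le0 -{1}[opnorm _]mul1r -mulrBl pmulr_rle0 // => zle.
have := le_opnorm_total x bZ.
have -> : opnorm (Defs.total Z) = 0 by apply/eqP; rewrite eq_le zle.
by rewrite mul0r => n0; apply/hnorm_eq0/eqP; rewrite eq_le n0 hnorm_ge0.
Qed.

Section Ideal.
Variables (I : set (H -> H)) (nrm : (H -> H) -> R).
Hypothesis hN : symmetric_norm I nrm.

Lemma ideal_sub X Y : I X -> I Y -> I (X - Y).
Proof.
move=> IX IY; have [_ h] := symn_subspace hN.
by rewrite -scaleN1r addrC; apply: h.
Qed.

Lemma ideal_add X Y : I X -> I Y -> I (X + Y).
Proof.
move=> IX IY; have [_ h] := symn_subspace hN.
by rewrite -[X]scale1r; apply: h.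
Qed.

Lemma nrm0 : nrm 0 = 0.
Proof.
have [I0 _] := symn_subspace hN.
by have := symn_scale hN 0 I0; rewrite scale0r normr0 mul0r.
Qed.

Lemma nrm_subC X Y : I X -> I Y -> nrm (X - Y) = nrm (Y - X).
Proof.
move=> IX IY; have := symn_scale hN (-1) (ideal_sub IX IY).
by rewrite scaleN1r opprB normrN normr1 mul1r.
Qed.

Lemma nrm_sandwich (A C : H -> H) (a c : R) X :
  bounded_op A -> bounded_op C -> 0 <= a -> 0 <= c ->
  (forall x, hnorm (A x) <= a * hnorm x) ->
  (forall x, hnorm (C x) <= c * hnorm x) -> I X ->
  I (A \o X \o C) /\ nrm (A \o X \o C) <= a * c * nrm X.
Proof.
move=> bA bC a0 c0 hA hC IX; have [IZ le] := symn_ideal hN IX bA bC.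
split=> //; apply: le_trans le _; have X0 := symn_ge0 hN IX.
rewrite mulrAC ler_wpM2r //; apply: ler_pM.
- by apply: opnorm_ge0; case: bA.
- by apply: opnorm_ge0; case: bC.
- by apply: opnorm_le => // x _; apply: hA.
- by apply: opnorm_le => // x _; apply: hC.
Qed.

(** Banach's fixed point theorem for [Phi X = G + B X N] in the complete space
[I]: the iterates [S n] from [0] stay bounded by [nrm G / (1 - q)], and
[S (n + k) - S n = B (S (n - 1 + k) - S (n - 1)) N] shrinks like [q ^+ n]. The
bound for the fixed point is [nrm T <= nrm G + q nrm T]. *)
Lemma sylvester_solution (G : H -> H) : I G ->
  exists T : H -> H, [/\ I T, T = G + (B \o T \o N) & nrm T <= nrm G / (1 - q)].
Proof.
move=> IG; have q1' : 0 < 1 - q by rewrite subr_gt0.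
pose Phi X : H -> H := G + (B \o X \o N).
have sw X : I X -> I (B \o X \o N) /\ nrm (B \o X \o N) <= q * nrm X.
  exact: nrm_sandwich.
have IPhi X : I X -> I (Phi X) by move=> /sw[h _]; apply: ideal_add.
have linB := bB.1.
have PhiB X Y : Phi X - Phi Y = B \o (X - Y) \o N.
  rewrite /Phi opprD addrACA subrr add0r; apply/funext => x /=.
  by rewrite [(X - Y) _]/(X _ - Y _) linmapB.
have lip X Y : I X -> I Y -> nrm (Phi X - Phi Y) <= q * nrm (X - Y).
  by move=> IX IY; rewrite PhiB; apply: (sw _ (ideal_sub IX IY)).2.
have bound X : I X -> X = Phi X -> nrm X <= nrm G / (1 - q).
  move=> IX e; rewrite ler_pdivlMr //.
  have [h1 h2] := sw X IX; have := symn_triangle hN IG h1.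
  by rewrite -/(Phi X) -e; lra.
pose S n := iter n Phi 0.
have IS n : I (S n).
  by elim: n => [|n /IPhi//]; case: (symn_subspace hN).
have nS n : nrm (S n) <= nrm G / (1 - q).
  rewrite ler_pdivlMr //; elim: n => [|n ih].
    by rewrite /S /= nrm0 mul0r (symn_ge0 hN).
  have [h1 h2] := sw _ (IS n); have h3 := symn_triangle hN IG h1.
  rewrite -/(Phi _) in h3.
  have : nrm (S n.+1) * (1 - q) <= (nrm G + q * nrm (S n)) * (1 - q).
    by rewrite ler_wpM2r ?(ltW q1') // (le_trans h3) // lerD.
  have := ler_wpM2l q0 ih; lra.
have dS n k : nrm (S (n + k)%N - S n) <= q ^+ n * (nrm G / (1 - q)).
  elim: n => [|n ih]; first by rewrite subr0 mul1r.
  rewrite addSn /S /= (le_trans (lip _ _ (IS _) (IS _))) //.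
  by rewrite exprS -mulrA ler_wpM2l.
have cauchyS e : 0 < e -> exists P, forall m n, (P <= m)%N -> (P <= n)%N ->
    nrm (S m - S n) < e.
  move=> e0; pose C := nrm G / (1 - q).
  have C0 : 0 <= C by rewrite divr_ge0 ?(symn_ge0 hN) // ltW.
  have e1 : 0 < e / (C + 1) by rewrite divr_gt0 // ltr_wpDl.
  have qn : (fun n => q ^+ n : R^o) @ \oo --> (0 : R^o).
    by apply: cvg_expr; rewrite ger0_norm.
  move/cvgrPdist_lt: qn => /(_ _ e1)[P _ hP]; exists P.
  have key m n : (P <= n)%N -> (n <= m)%N -> nrm (S m - S n) < e.
    move=> Pn nm; have := dS n (m - n)%N; rewrite subnKC // => h.
    have := hP n Pn; rewrite /= sub0r normrN ger0_norm ?exprn_ge0 //.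
    rewrite ltr_pdivlMr ?ltr_wpDl // => h2; apply: le_lt_trans h _.
    apply: le_lt_trans h2; rewrite mulrDr mulr1 lerDl exprn_ge0 //.
  move=> m n Pm Pn; case: (leqP n m) => [|/ltnW] nm; first exact: key.
  by rewrite nrm_subC // key.
have [T IT /cvgrPdist_lt ST] := symn_complete hN IS cauchyS.
have TPhi : T = Phi T.
  apply/eqP; rewrite -subr_eq0; apply/eqP/(symn_eq0 hN).
    by apply: ideal_sub => //; apply: IPhi.
  apply/eqP; rewrite eq_le (symn_ge0 hN) ?andbT; last first.
    by apply: ideal_sub => //; apply: IPhi.
  apply: (@le_eps (1 + q)) => [|e /ST[P _ hP]]; first exact: addr_ge0.
  have hn n : (P <= n)%N -> nrm (S n - T) < e.
    by move=> /hP /=; rewrite sub0r normrN; apply: le_lt_trans; apply: ler_norm.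
  have h1 := hn P.+1 (leqnSn P); have h2 := hn P (leqnn P).
  have -> : T - Phi T = (T - S P.+1) + (Phi (S P) - Phi T).
    by rewrite addrA subrK.
  have IPT := IPhi _ IT.
  have := symn_triangle hN (ideal_sub IT (IS P.+1)) (ideal_sub (IS P.+1) IPT).
  rewrite (nrm_subC IT) //; have := lip _ _ (IS P) IT.
  by have := ler_wpM2l q0 (ltW h2); rewrite -[S P.+1]/(Phi (S P)) in h1 *; lra.
by exists T; split=> //; apply: bound.
Qed.

End Ideal.
End Sylvester.

(** * The weak equation as a Sylvester equation *)

Section Equation.
Variables (HA HM : set H) (A M : operator H) (F : H -> H).
Hypotheses (hHA : closed_subspace HA) (hHM : closed_subspace HM)
  (hA : positive_definite_in HA A) (hM : positive_definite_in HM M)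
  (hMb : op_bounded M).

Let a := op_sqrt HA A.
Let m := op_sqrt HM M.
Let sA := hA.1.
Let sM := hM.1.
Let bA := posdef_bijective hHA hA.
Let bM := posdef_bijective hHM hM.
Let ha := op_sqrtP hHA hA.
Let hm := op_sqrtP hHM hM.
Let sa := sqrt_sa ha.
Let sm := sqrt_sa hm.
Let ba := sqrt_bijective bA ha.
Let bm := sqrt_bijective bM hm.

(** From left to right, test with [v = A^(-1/2) z] and [u = M^(1/2) w], where [w]
is the projection of [x]; every inverse square root then moves to the other
side of the inner product or cancels, and [z] is arbitrary. From right to left,
insert the operator identity at [w = M^(-1/2) u] and take the inner product
with [A^(1/2) v]. *)
Lemma weak_equationP (T : H -> H) : bounded_op_between HM HA T ->
  (forall v u, dom a v -> HM u ->
     '[a v, T (op_inv m u)] - '[v, op_inv a (T (m u))] = '[v, F u]) <->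
  T = (einv HA a \o F \o ext HM m) + (einv HA A \o T \o ext HM M).
Proof.
move=> [[linT _] TA T0].
have dM x : HM x -> dom M x := bounded_selfadjoint_total hHM sM hMb.
have MM x : HM x -> [/\ dom m x, dom m (m x) & m (m x) = M x].
  by move=> /dM dx; apply: (sqrt_comp hm dx).
have Min x : HM x -> HM (M x) by move=> /dM; apply: (selfadjoint_in_val sM).
split=> [eqT|TE v u dv Hu].
  apply/funext => x; rewrite [RHS](_ : _ =
    einv HA a (F (m (proj HM x))) + einv HA A (T (M (proj HM x)))) //.
  set w := proj HM x; have Hw : HM w by exact: proj_in.
  have [d1 d2 mm] := MM w Hw.
  have -> : T x = T w.
    apply/eqP; rewrite -subr_eq0 -(linmapB linT); apply/eqP/T0 => y.
    exact: proj_orth.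
  apply: inner_ext => z; have := eqT (einv HA a z) (m w) (einv_dom hHA ba z).
  move=> /(_ (selfadjoint_in_val sm d1)).
  rewrite (op_invK sm bm d1) mm (einvE a hHA); last exact/TA/Min.
  rewrite (einvK hHA ba) (projEl hHA _ (TA _ Hw)) !(einv_sym hHA sa ba).
  rewrite (einv_sqrt hHA bA ha) innerDr => <-.
  by rewrite subrK.
have [dw mw] := op_invP bm Hu; set w := op_inv m u in dw mw *.
have Hw := selfadjoint_in_sub sm dw; have [_ _ mm] := MM w Hw.
have e : T w = einv HA a (F u) + einv HA A (T (m u)).
  rewrite {1}TE [LHS](_ : _ =
    einv HA a (F (m (proj HM w))) + einv HA A (T (M (proj HM w)))) //.
  by rewrite (proj_id hHM Hw) -mm mw.
rewrite e -(einv_sqrt hHA bA ha) -(linmapD (einv_linear hHA sa ba)).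
rewrite -(einv_sym hHA sa ba) (einv_op hHA sa ba dv) innerDr.
rewrite (einvE a hHA) ?addrK //; apply: TA; rewrite -mw mm.
exact: Min.
Qed.

(** Both terms of the identity start with a projection onto [HM] and end with an
operator into [HA]. *)
Lemma fixpoint_between (T : H -> H) : bounded_op T ->
  T = (einv HA a \o F \o ext HM m) + (einv HA A \o T \o ext HM M) ->
  F 0 = 0 -> bounded_op_between HM HA T.
Proof.
move=> bT TE F0; have TEx x : T x =
    einv HA a (F (m (proj HM x))) + einv HA A (T (M (proj HM x))).
  by rewrite {1}TE.
split=> // x hx; rewrite TEx.
  by apply: closed_subspaceD => //; [apply: einv_in sa ba _|apply: einv_in sA bA _].
rewrite (proj_eq0 hHM hx) (domain0 sm).2 (domain0 sM).2 F0 (linmap0 bT.1).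
rewrite (linmap0 (einv_linear hHA sa ba)) (linmap0 (einv_linear hHA sA bA)).
exact: addr0.
Qed.

End Equation.

(** The constant of the geometric series, rewritten in terms of [D = 1 / alpha]. *)
Lemma resolvent_constant (alpha mu f : R) :
  0 < alpha -> 0 <= mu -> alpha * mu < 1 ->
  Num.sqrt alpha * Num.sqrt mu * f / (1 - alpha * mu) =
  Num.sqrt (1 / alpha * mu) / (1 / alpha - mu) * f.
Proof.
move=> a0 m0 q1; rewrite !mul1r sqrtrM ?invr_ge0 ?ltW // sqrtrV ?ltW //.
have s0 : 0 < Num.sqrt alpha by rewrite sqrtr_gt0.
have aE : alpha = Num.sqrt alpha ^+ 2 by rewrite sqr_sqrtr ?ltW.
move: q1; rewrite [X in X * mu < 1]aE [X in 1 - X * _]aE [X in X^-1 - _]aE.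
move: (Num.sqrt alpha) s0 => s s0 q1.
by field; rewrite gt_eqF //= mulNr mulrC gt_eqF ?subr_gt0.
Qed.

End Hilbert.

Theorem theorem2p8 (R : realType) (H : hilbertType R) (HA HM : set H)
    (A M : operator H) (F : H -> H)
    (I : set (H -> H)) (nrm : (H -> H) -> R)
    (hHA : closed_subspace HA) (hHM : closed_subspace HM)
    (hA : positive_definite_in HA A) (hM : positive_definite_in HM M)
    (hMb : op_bounded M)
    (hF : bounded_op_between HM HA F)
    (D := 1 / opnorm (op_inv A)) (hMD : opnorm M < D)
    (hN : symmetric_norm I nrm) (hP : property_P I nrm) (hFI : I F) :
  let A_half := op_sqrt HA A in
  let M_half := op_sqrt HM M in
  let solution (T : H -> H) :=
    bounded_op_between HM HA T /\
    forall v u : H, dom A_half v -> HM u ->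
      '[A_half v, T (op_inv M_half u)] - '[v, op_inv A_half (T (M_half u))]
      = '[v, F u] in
  (exists! T : H -> H, solution T) /\
  (forall T : H -> H, solution T ->
     I T /\ nrm T <= Num.sqrt (D * opnorm M) / (D - opnorm M) * nrm F).
Proof.
move=> a m solution.
have sA := hA.1; have sM := hM.1.
have bA := posdef_bijective hHA hA; have bM := posdef_bijective hHM hM.
have ha := op_sqrtP hHA hA; have hm := op_sqrtP hHM hM.
have sa := sqrt_sa ha; have ba := sqrt_bijective bA ha.
pose alpha := opnorm (op_inv A); pose mu := opnorm M.
have alpha0 : 0 <= alpha.
  apply: opnorm_ge0; last exact: op_inv_bounded hHA hA.
  by have [] := op_inv_linear hHA hA.
have mu0 : 0 <= mu by apply: opnorm_ge0 => //; exact: (domain0 sM).1.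
(* if [alpha = 0] then [D = 1 / 0 = 0], which contradicts [mu < D] *)
have alpha_gt0 : 0 < alpha.
  rewrite lt0r alpha0 andbT; apply: contraTN hMD => /eqP alphaE.
  by rewrite -leNgt /D -/alpha alphaE invr0 mulr0.
have q1 : alpha * mu < 1.
  by move: hMD; rewrite /D -/alpha -/mu ltr_pdivlMr // mulrC.
have nB := einv_norm hHA hA; have nb := einv_sqrt_norm hHA hA.
have nN := ext_norm hHM hM hMb; have nn := ext_sqrt_norm hHM hM hMb.
have bB : bounded_op (einv HA A).
  exact: bounded_op_norm (einv_linear hHA sA bA) nB.
have bb : bounded_op (einv HA a).
  exact: bounded_op_norm (einv_linear hHA sa ba) nb.
have bN : bounded_op (ext HM M).
  apply: bounded_op_norm nN; apply: (ext_linear hHM sM) => x.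
  exact: (bounded_selfadjoint_total hHM sM hMb).
have bn : bounded_op (ext HM m).
  apply: bounded_op_norm nn; apply: (ext_linear hHM (sqrt_sa hm)) => x.
  exact: dom_bounded_sqrt.
have [IG nG] := nrm_sandwich hN bb bn (sqrtr_ge0 _) (sqrtr_ge0 _) nb nn hFI.
have [T [IT TE nT]] := sylvester_solution bB bN alpha0 mu0 q1 nB nN hN IG.
have F0 : F 0 = 0 by case: hF => -[linF _] _ _; apply: linmap0.
have bT := symn_bounded hN IT.
have TAM := fixpoint_between hHA hHM hA hM bT TE F0.
have solT : solution T.
  by split=> //; apply/(weak_equationP F hHA hHM hA hM hMb TAM).
have uniq X : solution X -> T = X.
  move=> [XAM /(weak_equationP F hHA hHM hA hM hMb XAM) XE].
  have bX : bounded_op X by case: XAM.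
  apply/funext => x; apply/eqP; rewrite -subr_eq0; apply/eqP.
  apply: (sandwich_fixpoint_eq0 alpha0 mu0 q1 nB nN (bounded_op_sub bT bX)).
  move=> y; rewrite [LHS](_ : _ = T y - X y) // {1}TE {1}XE.
  rewrite [(T - X) _](_ : _ = T (ext HM M y) - X (ext HM M y)) //.
  rewrite (linmapB bB.1) [LHS](_ : _ =
    einv HA a (F (ext HM m y)) + einv HA A (T (ext HM M y)) -
    (einv HA a (F (ext HM m y)) + einv HA A (X (ext HM M y)))) //.
  by rewrite opprD addrACA subrr add0r.
split; first by exists T; split.
move=> X /uniq <-; split=> //.
rewrite -resolvent_constant //; apply: le_trans nT _.
by rewrite ler_pM2r // invr_gt0 subr_gt0.
Qed.
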